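(* Let $\mathscr{H}$ be a real Hilbert space, let $A:\mathscr{H}\to 2^{\mathscr{H}}$ be maximal monotone, let $B:\mathscr{H}\to\mathscr{H}$ be monotone and $L$-Lipschitz continuous for some $L>0$, and suppose that $\Omega:=(A+B)^{-1}(\mathbf{0})=\{x\in\mathscr{H}:\mathbf{0}\in A(x)+B(x)\}$ is nonempty. Let $0<\alpha<\tfrac13$, let $\beta\in\left[0,\frac{1-3\alpha}{3(1-\alpha)}\right)$, and let $\{\theta_n\}_{n\ge1}$ be a real sequence with $0\le\theta_n\le\theta_{n+1}\le1$ for all $n\ge 1$. Then any sequence $\{x_n\}$ generated by Algorithm IPCMAS1 (described in the context) converges weakly to a point of $\Omega$.
   Context: For $\lambda>0$, the resolvent of a maximal monotone operator $A$ is the single-valued map $J^A_\lambda:=(I+\lambda A)^{-1}:\mathscr{H}\to\mathscr{H}$. Algorithm IPCMAS1. Choose $\mu\in(0,1)$, $\gamma\in(0,2)$, $\lambda_1>0$, a nonnegative real sequence $\{\xi_n\}_{n\ge1}$ with $\sum_{n=1}^\infty\xi_n<+\infty$, and starting points $x_0,x_1\in\mathscr{H}$ (all arbitrary subject to these constraints). For $n=1,2,\dots$ compute $$z_n=x_n+\beta(x_n-x_{n-1}),\qquad w_n=x_n+\theta_n(x_n-x_{n-1}),\qquad y_n=J^A_{\lambda_n}\big(w_n-\lambda_nB(w_n)\big).$$ If $y_n=w_n$, stop ($y_n$ is a solution). Otherwise set $$d_n=w_n-y_n-\lambda_n\big(B(w_n)-B(y_n)\big),\qquad \eta_n=\begin{cases}\dfrac{\langle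 w_n-y_n,d_n\rangle}{\|d_n\|^2},&d_n\neq0,\\ 0,&d_n=0,\end{cases}$$ $$u_n=w_n-\gamma\eta_nd_n,\qquad x_{n+1}=(1-\alpha)z_n+\alpha u_n,$$ and update $$\lambda_{n+1}=\begin{cases}\min\left\{\dfrac{\mu\|w_n-y_n\|}{\|B(w_n)-B(y_n)\|},\ \lambda_n+\xi_n\right\},&B(w_n)\neq B(y_n),\\ \lambda_n+\xi_n,&\text{otherwise.}\end{cases}$$ Statements about the generated sequence $\{x_n\}$ concern infinite runs, i.e. the case in which the algorithm never stops ($y_n\ne w_n$ for all $n\ge1$). *)

(* Defs.v *)
From HB Require Import structures.
From mathcomp Require Import all_boot all_order all_algebra.
From mathcomp Require Import all_classical all_reals all_analysis.

Set Implicit Arguments.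
Unset Strict Implicit.
Unset Printing Implicit Defensive.

Import Order.TTheory GRing.Theory Num.Theory.
Import numFieldNormedType.Exports.

Local Open Scope classical_set_scope.
Local Open Scope ring_scope.

(* A real Hilbert space is a complete normed space
   [H] over a [realType] with an inner product [ip] (a symmetric positive
   definite bilinear form) inducing the norm of [H]. *)
Definition induces_norm (R : realType) (H : completeNormedModType R)
    (ip : {dot H for (@idfun R)}) : Prop :=
  forall x : H, `|x| ^+ 2 = ip x x.

Section Operators.
Variables (R : realType) (H : completeNormedModType R).
Variable ip : {dot H for (@idfun R)}.

Definition weakly_converges_to (x : nat -> H) (p : H) : Prop :=
  forall h : H, (fun n => ip (x n) h) @ \oo --> ip p h.

(* A set-valued operator is a map [A : H -> set H]; [A x a] reads a \in A(x). *)
Definition set_monotone (A : H -> set H) : Prop :=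
  forall x y a b : H, A x a -> A y b -> 0 <= ip (x - y) (a - b).

Definition maximal_monotone (A : H -> set H) : Prop :=
  set_monotone A /\
  forall A' : H -> set H, set_monotone A' ->
    (forall x, A x `<=` A' x) -> forall x, A' x `<=` A x.

Definition monotone_map (B : H -> H) : Prop :=
  forall x y : H, 0 <= ip (x - y) (B x - B y).

Definition zeros_sum (A : H -> set H) (B : H -> H) : set H :=
  [set x | [set a + B x | a in A x] 0].

(* For [A] maximal monotone and [lam > 0] the set (I + lam A)^-1 (v) below is a
   singleton (Minty), so the default value 0 of [xget] is never used. *)
Definition resolvent (A : H -> set H) (lam : R) (v : H) : H :=
  xget 0 [set y | [set y + lam *: a | a in A y] v].

(* An infinite run (one that never stops) of the algorithm.  All sequences are
   indexed from 1, except [x], which starts at [x 0]; the values of the other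
   sequences at 0 are irrelevant. *)
Record IPCMAS1_infinite_run (A : H -> set H) (B : H -> H)
    (alpha beta : R) (theta : nat -> R)
    (mu gamma : R) (xi : nat -> R)
    (x z w y d u : nat -> H) (eta lam : nat -> R) : Prop := {
  run_mu : 0 < mu < 1;
  run_gamma : 0 < gamma < 2;
  run_lam1 : 0 < lam 1%N;
  run_xi_ge0 : forall n, (1 <= n)%N -> 0 <= xi n;
  run_xi_summable : (\sum_(1 <= n <oo) (xi n)%:E < +oo)%E;
  run_z : forall n, (1 <= n)%N -> z n = x n + beta *: (x n - x n.-1);
  run_w : forall n, (1 <= n)%N -> w n = x n + theta n *: (x n - x n.-1);
  run_y : forall n, (1 <= n)%N ->
    y n = resolvent A (lam n) (w n - lam n *: B (w n));
  run_nonstop : forall n, (1 <= n)%N -> y n <> w n;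
  run_d : forall n, (1 <= n)%N ->
    d n = w n - y n - lam n *: (B (w n) - B (y n));
  run_eta : forall n, (1 <= n)%N ->
    eta n = if d n != 0 then ip (w n - y n) (d n) / `|d n| ^+ 2 else 0;
  run_u : forall n, (1 <= n)%N -> u n = w n - (gamma * eta n) *: d n;
  run_x : forall n, (1 <= n)%N ->
    x n.+1 = (1 - alpha) *: z n + alpha *: u n;
  run_lam : forall n, (1 <= n)%N ->
    lam n.+1 =
      if B (w n) != B (y n) then
        Num.min (mu * `|w n - y n| / `|B (w n) - B (y n)|) (lam n + xi n)
      else lam n + xi n
}.

End Operators.

(* Main.v *)
Require Import Defs.
From HB Require Import structures.
From mathcomp Require Import all_boot all_order all_algebra.
From mathcomp Require Import all_classical all_reals all_analysis.
From mathcomp Require Import ring lra.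
Import Order.TTheory GRing.Theory Num.Theory.
Import numFieldNormedType.Exports.
Local Open Scope classical_set_scope.
Local Open Scope ring_scope.

(* With [a n = |x n - p|^2] and [D n = |x n.+1 - x n|^2], where [p] is a zero of
   [A + B], the step [u n] is no farther from [p] than [w n] as soon as the
   variable stepsizes have nearly stabilised.  Hence, for the nondecreasing
   weights [s n = (1 - alpha) beta + alpha theta n <= 1/3],
     a n.+2 <= (1 + s n) a n.+1 - s n a n + r D n - q D n.+1   with r < q,
   so that [a n.+1 - s n a n + r D n] decreases, [D n] tends to 0 and [a n]
   converges.  All residuals then tend to 0, weak cluster points are zeros of
   [A + B] by demiclosedness, and Opial's lemma concludes.  Minty's theorem and
   the Riesz representation theorem are both obtained by minimising a strongly
   convex function given by its epigraph. *)

(** * Real sequences and the inequality between the coefficients *)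

Lemma almost_nonincreasing_cvgn (R : realType) (a e : nat -> R) (m M : R) :
  (forall n, 0 <= e n) -> (forall n, \sum_(0 <= i < n) e i <= M) ->
  (forall n, a n.+1 <= a n + e n) -> (forall n, m <= a n) -> cvgn a.
Proof.
move=> e0 eM ae am.
pose S n := \sum_(0 <= i < n) e i.
have cvS : cvgn S.
  apply: nondecreasing_is_cvgn.
    by apply/nondecreasing_seqP => n; rewrite /S big_nat_recr//= lerDl.
  by exists M => _ [n _ <-]; exact: eM.
(* Subtracting the partial sums of [e] turns [a] into a nonincreasing sequence. *)
have cvaS : cvgn (fun n => a n - S n).
  apply: nonincreasing_is_cvgn.
    apply/nonincreasing_seqP => n; rewrite /S big_nat_recr//=.
    by have := ae n; lra.
  by exists (m - M) => _ [n _ <-]; have := am n; have := eM n; rewrite /S; lra.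
have -> : a = (fun n => (a n - S n) + S n) by apply/funext => n; rewrite subrK.
exact: is_cvgD.
Qed.

Lemma inertial_descent (R : realType) (a D s : nat -> R) (r q : R) :
  0 <= r < q -> (forall n, 0 <= a n) -> (forall n, 0 <= D n) ->
  (forall n, 0 <= s n <= 1 / 3) -> (forall n, s n <= s n.+1) ->
  (forall n, a n.+2 <= (1 + s n) * a n.+1 - s n * a n + r * D n - q * D n.+1) ->
  [/\ exists M, forall n, a n <= M, D @ \oo --> 0 &
      cvgn (fun n => a n.+1 - s n * a n)].
Proof.
move=> /andP[r0 rq] a0 D0 s01 sS aS.
pose G n := a n.+1 - s n * a n + r * D n.
(* The growth of [s] enters here: once [s n.+1 * a n.+1] is bounded below by [s n * a n.+1], all
   terms in [a] cancel. *)
have GS n : (q - r) * D n.+1 <= G n - G n.+1.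
  have := aS n; have := ler_wpM2r (a0 n.+1) (sS n).
  by rewrite /G; lra.
have GD n : G n.+1 <= G n.
  rewrite -subr_ge0; apply: le_trans (GS n).
  by rewrite mulr_ge0// subr_ge0 ltW.
have Gle0 n : G n <= G 0%N by elim: n => // n; exact/le_trans.
(* The factor [3 / 2] matches [s n <= 1 / 3]: the bound propagates by [a n.+1 <= G 0 + s n * a n <=
   2 / 3 * M + 1 / 3 * M]. *)
pose M := Num.max (a 0%N) (3 / 2 * G 0%N).
have M0 : 0 <= M by rewrite le_max a0.
have GM : 3 / 2 * G 0%N <= M by rewrite le_max lexx orbT.
have aM n : a n <= M.
  elim: n => [|n IHn]; first by rewrite le_max lexx.
  have /andP[sn0 sn1] := s01 n.
  have h : s n * a n <= 1 / 3 * M by rewrite ler_pM.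
  have : a n.+1 - s n * a n <= G 0%N.
    by apply: le_trans (Gle0 n); rewrite /G lerDl mulr_ge0.
  by lra.
have cvG : cvgn G.
  apply: nonincreasing_is_cvgn; first exact/nonincreasing_seqP.
  exists (- M) => _ [n _ <-]; have /andP[sn0 sn1] := s01 n.
  have h : s n * a n <= 1 * M by rewrite ler_pM//; lra.
  have := a0 n.+1; have := mulr_ge0 r0 (D0 n); rewrite /G; lra.
have cvD : D @ \oo --> 0.
  rewrite -(cvg_shiftS D); move/cvg_ex: cvG => [g Gg].
  apply: (@squeeze_cvgr _ _ _ _ (fun=> 0) (fun n => (q - r)^-1 * (G n - G n.+1))).
  - by near=> n; rewrite D0/= ler_pdivlMl ?subr_gt0.
  - exact: cvg_cst.
  - rewrite -(mulr0 (q - r)^-1) -(subrr g); apply: cvgMr; apply: cvgB => //.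
    by rewrite (cvg_shiftS G).
split=> //; first by exists M.
have -> : (fun n => a n.+1 - s n * a n) = fun n => G n - r * D n.
  by apply/funext => n; rewrite /G addrK.
apply: is_cvgB => //; apply/cvg_ex; exists (r * 0); exact: cvgMr.
Unshelve. all: by end_near.
Qed.

(** Multiplied by [alpha], the gap between the two sides is at least
    [4 / 9 - 4 / 27 - 2 / 9 = 2 / 27]. The bound on [beta] reads
    [(1 - alpha) * beta < 1 / 3 - alpha], whence [(1 - alpha) * (1 - beta) > 2 / 3]. *)
Lemma inertial_coef_lt (R : realFieldType) (alpha beta : R) :
  0 < alpha < 1 / 3 -> 0 <= beta < (1 - 3 * alpha) / (3 * (1 - alpha)) ->
  (1 - alpha) * beta * (1 + beta) + 2 * alpha
    + (1 - alpha) * beta * (1 - beta) / alpha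
  < (1 - alpha) * (1 - beta) / alpha.
Proof.
move=> /andP[a0 a13] /andP[b0]; rewrite ltr_pdivlMr; last by lra.
move=> hb.
have b13 : beta <= 1 / 3 by nra.
rewrite -subr_gt0.
have -> : (1 - alpha) * (1 - beta) / alpha - ((1 - alpha) * beta * (1 + beta)
    + 2 * alpha + (1 - alpha) * beta * (1 - beta) / alpha) =
  ((1 - alpha) * (1 - beta) * (1 - beta)
     - alpha * ((1 - alpha) * beta) * (1 + beta) - 2 * alpha ^+ 2) / alpha.
  by field; rewrite gt_eqF.
rewrite divr_gt0//.
have h1 : 4 / 9 <= (1 - alpha) * (1 - beta) * (1 - beta).
  have -> : 4 / 9 = (2 / 3) * (2 / 3) :> R by field.
  by apply: ler_pM; lra.
have h2 : alpha * ((1 - alpha) * beta) <= 1 / 3 * (1 / 3).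
  by apply: ler_pM; rewrite ?mulr_ge0//; lra.
have h3 : alpha * ((1 - alpha) * beta) * (1 + beta) <= 1 / 9 * (4 / 3).
  apply: ler_pM; rewrite ?mulr_ge0//; lra.
have h4 : alpha ^+ 2 <= 1 / 9 by nra.
by lra.
Qed.

(** * Limits along ultrafilters, and contractions *)

Lemma cvg_ultra (T : Type) (V : topologicalType) (F : set_system T)
    (f : T -> V) (l : V) : ProperFilter F ->
  (forall U, UltraFilter U -> F `<=` U -> f @ U --> l) -> f @ F --> l.
Proof.
move=> FF h N Nl; apply: contrapT => FN.
(* If the preimage of [N] is not in [F], then [F] can be restricted to its complement, and an
   ultrafilter refining the restriction contradicts [h]. *)
have GF : ProperFilter (within (~` (f @^-1` N)) F).
  apply: Build_ProperFilter (within_filter _ _).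
  by move=> /= F0; apply: FN; near=> x; apply: contrapT; near: x.
have [U [UU FU]] := ultraFilterLemma GF.
have FsubU : F `<=` U by move=> A FA; apply: FU; apply: filterS FA => x Ax _.
have UC : U (~` (f @^-1` N)).
  by apply: FU; rewrite /within /=; apply: filterS filterT.
have UN : U (f @^-1` N) := h U UU FsubU N Nl.
have : U (~` (f @^-1` N) `&` f @^-1` N) by exact: filterI.
move=> /filter_ex[x [/= NNx Nx]].
exact: NNx.
Unshelve. all: by end_near.
Qed.

(** Compactness of the segment gives a cluster point, and an ultrafilter converges to its cluster
    points because it contains each set or its complement. *)
Lemma ultra_bounded_cvg (R : realType) (T : Type) (U : set_system T)
    (f : T -> R) (M : R) : UltraFilter U -> (forall t, `|f t| <= M) ->
  exists l : R, f @ U --> l.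
Proof.
move=> UU fM.
have [|l [_ cl]] := @segment_compact R (- M) M (f @ U).
  by apply: (@filterS _ U _ setT _ _ filterT) => t _; rewrite /= in_itv /= -ler_norml.
exists l => N Nl; have [//|UC] := in_ultra_setVsetC (f @^-1` N) UU.
by have [y [/= NNy Ny]] := cl (~` N) N UC Nl.
Qed.

Lemma lipschitz_fixed_point (R : realType) (V : completeNormedModType R)
    (f : V -> V) (k : R) : 0 <= k < 1 ->
  (forall x y, `|f x - f y| <= k * `|x - y|) -> exists x, f x = x.
Proof.
move=> /andP[k0 k1] fk.
have fT : {homo f : x / [set: V] x >-> [set: V] x} by [].
have [||//|x _ xE] := @banach_fixed_point R V setT (mkfun_fun fT).
- by exists (NngNum k0); split => //= -[x y] _; exact: fk.
- exact: closedT.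
- by exists 0.
- by exists x.
Qed.

(** * Inner product calculus in a Hilbert space *)

Section Hilbert.
Variables (R : realType) (H : completeNormedModType R).
Variable ip : {dot H for (@idfun R)}.
Hypothesis hip : induces_norm ip.

Lemma ipC (x y : H) : ip x y = ip y x.
Proof. by rewrite hermC /= expr0 mul1r. Qed.

Lemma ipDl (x y z : H) : ip (x + y) z = ip x z + ip y z.
Proof. exact: linearDl. Qed.
Lemma ipNl (x z : H) : ip (- x) z = - ip x z.
Proof. exact: linearNl. Qed.
Lemma ipZl a (x z : H) : ip (a *: x) z = a * ip x z.
Proof. by rewrite linearZl_LR. Qed.
Lemma ipDr (x y z : H) : ip z (x + y) = ip z x + ip z y.
Proof. by rewrite ipC ipDl !(ipC z). Qed.
Lemma ipNr (x z : H) : ip z (- x) = - ip z x.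
Proof. by rewrite ipC ipNl ipC. Qed.
Lemma ipZr a (x z : H) : ip z (a *: x) = a * ip z x.
Proof. by rewrite ipC ipZl ipC. Qed.
Lemma ip0l (z : H) : ip 0 z = 0.
Proof. by rewrite -(scale0r 0) ipZl mul0r. Qed.
Lemma ip0r (z : H) : ip z 0 = 0.
Proof. by rewrite ipC ip0l. Qed.

Definition ipE := (ipDl, ipNl, ipZl, ipDr, ipNr, ipZr, ip0l, ip0r).

Lemma ip_ge0 (x : H) : 0 <= ip x x.
Proof. by rewrite -hip sqr_ge0. Qed.

Lemma ip_eq0 (x : H) : ip x x = 0 -> x = 0.
Proof. by rewrite -hip => /eqP; rewrite expf_eq0 normr_eq0 => /eqP. Qed.

Lemma cauchy_schwarz (x y : H) : ip x y <= `|x| * `|y|.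
Proof.
have [->|x0] := eqVneq x 0; first by rewrite ip0l normr0 mul0r.
have nx : 0 < `|x| by rewrite normr_gt0.
have := ip_ge0 (`|x| *: y - `|y| *: x); rewrite !ipE -!hip (ipC y x) => h.
have : 0 <= `|x| * `|y| * (`|x| * `|y| - ip x y) *+ 2.
  by apply: le_trans h _; rewrite le_eqVlt; apply/orP; left; apply/eqP; ring.
have [->|y0] := eqVneq y 0; first by rewrite ip0r normr0 mulr0.
have ny : 0 < `|y| by rewrite normr_gt0.
by rewrite pmulrn_lge0// pmulr_rge0 ?mulr_gt0// subr_ge0.
Qed.

Lemma cauchy_schwarz_abs (x y : H) : `|ip x y| <= `|x| * `|y|.
Proof.
rewrite ler_norml cauchy_schwarz andbT lerNl -ipNl.
by rewrite (le_trans (cauchy_schwarz _ _))// normrN.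
Qed.

Lemma sqr_norm_cvg (T : Type) (F : set_system T) (FF : Filter F) (x : T -> H) p :
  x @ F --> p -> `|x n| ^+ 2 @[n --> F] --> `|p| ^+ 2.
Proof. by move=> xp; rewrite expr2; apply: cvgM; exact: cvg_norm. Qed.

Lemma polarization (x y : H) :
  ip x y = (`|x + y| ^+ 2 - `|x - y| ^+ 2) / 4.
Proof. by rewrite !hip !ipE (ipC y x); field. Qed.

Lemma cvg_ip (T : Type) (F : set_system T) (FF : Filter F) (x y : T -> H) p q :
  x @ F --> p -> y @ F --> q -> ip (x n) (y n) @[n --> F] --> ip p q.
Proof.
move=> xp yq; under eq_fun do rewrite polarization.
rewrite polarization; apply: cvgMl; apply: cvgB; apply: sqr_norm_cvg.
- exact: cvgD.
- exact: cvgB.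
Qed.

(** * Strongly convex minimisation, with the theorems of Riesz and Minty *)

Lemma cvgn_sqr_dist (x : nat -> H) (c : R) :
  (forall n k, `|x n - x k| ^+ 2 <= c * (n.+1%:R^-1 + k.+1%:R^-1)) -> cvgn x.
Proof.
move=> xc; apply/cauchy_cvgP; apply/cauchy_exP => e e0.
have h0 : c * (2 * n.+1%:R^-1 : R) @[n --> \oo] --> (0 : R).
  rewrite -(mulr0 c) -(mulr0 2); apply: cvgMr; apply: cvgMr; exact: cvg_harmonic.
have e20 : 0 < e ^+ 2 by rewrite exprn_gt0.
have [N _ hN] := cvgr0_norm_lt _ h0 _ e20.
exists (x N); exists N => // n /= Nn; rewrite -ball_normE /=.
rewrite -(ltr_pXn2r (n := 2)) ?nnegrE ?normr_ge0 ?ltW//.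
apply: le_lt_trans (xc _ _) _.
have := hN N (leqnn N); rewrite /= => hN'.
have c0 : 0 <= c.
  have := le_trans (sqr_ge0 _) (xc 0%N 0%N).
  by rewrite invr1 pmulr_lge0// addr_gt0.
apply: le_lt_trans (le_lt_trans (ler_norm _) hN').
rewrite ler_wpM2l// mulrDl mul1r lerD2l lef_pV2 ?posrE ?ltr0n//.
by rewrite ler_nat.
Qed.

Lemma ge0_of_small_perturbation (K Q : R) : 0 <= Q ->
  (forall s, 0 < s <= 1 -> 0 <= K + s * Q) -> 0 <= K.
Proof.
move=> Q0 h; rewrite leNgt; apply/negP => K0.
have D0 : 0 < Q - 2 * K by lra.
have K2 : 0 < K ^+ 2 by rewrite exprn_even_gt0//= lt_eqF.
(* For [K < 0] this choice of [s] gives [K + s * Q = - 2 * K ^+ 2 / (Q - 2 * K) < 0]. *)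
have s01 : 0 < - K / (Q - 2 * K) <= 1.
  by rewrite divr_gt0 ?oppr_gt0//= ler_pdivrMr//; lra.
have := h _ s01.
have -> : K + - K / (Q - 2 * K) * Q = - (2 * K ^+ 2) / (Q - 2 * K).
  by field; rewrite gt_eqF.
by rewrite pmulr_lge0 ?invr_gt0//; lra.
Qed.

(** [E] stands for the epigraph of a closed convex function on the product space, which may thus
    take infinite values. A minimising sequence of this function plus half the squared norm is
    Cauchy by strong convexity, and the conclusion is the first-order condition at its limit. *)
Lemma convex_argmin (E : set (H * H * R)) (m : R) :
  E !=set0 ->
  (forall x u t x' u' t' s, 0 <= s <= 1 -> E (x, u, t) -> E (x', u', t') ->
    E (x + s *: (x' - x), u + s *: (u' - u), t + s * (t' - t))) ->
  (forall (x u : nat -> H) (t : nat -> R) x0 u0 t0,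
     (forall n, E (x n, u n, t n)) ->
     x @ \oo --> x0 -> u @ \oo --> u0 -> t @ \oo --> t0 -> E (x0, u0, t0)) ->
  (forall x u t, E (x, u, t) -> m <= t + (`|x| ^+ 2 + `|u| ^+ 2) / 2) ->
  exists x0 u0 t0, E (x0, u0, t0) /\
    forall x u t, E (x, u, t) -> 0 <= t - t0 + ip x0 (x - x0) + ip u0 (u - u0).
Proof.
move=> [e0 Ee0] convE closedE lbE.
pose J (e : H * H * R) := e.2 + (`|e.1.1| ^+ 2 + `|e.1.2| ^+ 2) / 2.
have infJ : has_inf [set J e | e in E].
  split; first by exists (J e0); exists e0.
  by exists m => _ [[[x u] t] Ee <-]; exact: lbE.
set mm := inf [set J e | e in E] in infJ.
have mmP x u t : E (x, u, t) -> mm <= t + (`|x| ^+ 2 + `|u| ^+ 2) / 2.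
  by move=> Ee; apply: (ge_inf infJ.2); exists (x, u, t).
have /choice[e eP] : forall n : nat, exists e, E e /\ J e < mm + n.+1%:R^-1.
  move=> n; have /inf_adherent/(_ infJ)[_ [e Ee <-] ?] : 0 < n.+1%:R^-1 :> R.
    by rewrite invr_gt0.
  by exists e.
pose x n := (e n).1.1; pose u n := (e n).1.2; pose t n := (e n).2.
have Exut n : E (x n, u n, t n).
  by have [] := eP n; rewrite /x /u /t; case: (e n) => [[]].
have Jxut n : t n + (`|x n| ^+ 2 + `|u n| ^+ 2) / 2 < mm + n.+1%:R^-1.
  by have [] := eP n.
have cauchy_xu n k :
    `|x n - x k| ^+ 2 + `|u n - u k| ^+ 2 <= 4 * (n.+1%:R^-1 + k.+1%:R^-1).
  (* At the midpoint of two near-minimisers, [J] is below the mean of their values by an eighth of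
     the squared distance, yet still at least [mm]. *)
  have h01 : 0 <= (2^-1 : R) <= 1 by lra.
  have := mmP _ _ _ (convE _ _ _ _ _ _ _ h01 (Exut n) (Exut k)).
  have := Jxut n; have := Jxut k; rewrite !hip !ipE.
  rewrite (ipC (x k) (x n)) (ipC (u k) (u n)).
  by move: (n.+1%:R^-1) (k.+1%:R^-1) => a b; lra.
have /cvgn_sqr_dist/cvg_ex[x0 xx0] n k :
    `|x n - x k| ^+ 2 <= 4 * (n.+1%:R^-1 + k.+1%:R^-1).
  by apply: le_trans (cauchy_xu n k); rewrite lerDl sqr_ge0.
have /cvgn_sqr_dist/cvg_ex[u0 uu0] n k :
    `|u n - u k| ^+ 2 <= 4 * (n.+1%:R^-1 + k.+1%:R^-1).
  by apply: le_trans (cauchy_xu n k); rewrite lerDr sqr_ge0.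
have Jcvg : t n + (`|x n| ^+ 2 + `|u n| ^+ 2) / 2 @[n --> \oo] --> mm.
  apply: (@squeeze_cvgr _ _ _ _ (fun=> mm) (fun n => mm + n.+1%:R^-1)).
  - by near=> n; rewrite mmP//= ltW.
  - exact: cvg_cst.
  - by rewrite -[X in _ --> X]addr0; apply: cvgD (cvg_cst _) cvg_harmonic.
(* [t0] is the height at which [J] equals its infimum [mm] over [(x0, u0)]. *)
pose t0 := mm - (`|x0| ^+ 2 + `|u0| ^+ 2) / 2.
have tt0 : t @ \oo --> t0.
  have -> : t = fun n => t n + (`|x n| ^+ 2 + `|u n| ^+ 2) / 2
      - (`|x n| ^+ 2 + `|u n| ^+ 2) / 2 by apply/funext => n; rewrite addrK.
  by apply: cvgB => //; apply: cvgMl; apply: cvgD; exact: sqr_norm_cvg.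
have E0 := closedE _ _ _ _ _ _ Exut xx0 uu0 tt0.
exists x0, u0, t0; split => // x' u' t' E'.
(* A move by [s] towards the competitor changes [J] by [s] times the first-order term plus [s ^+ 2]
   times this quadratic term; divide by [s]. *)
apply: (@ge0_of_small_perturbation _ ((`|x' - x0| ^+ 2 + `|u' - u0| ^+ 2) / 2)).
  by rewrite divr_ge0// addr_ge0// sqr_ge0.
move=> s /andP[s0 s1].
have s01 : 0 <= s <= 1 by rewrite ltW.
have := mmP _ _ _ (convE _ _ _ _ _ _ _ s01 E0 E').
rewrite -(pmulr_rge0 _ s0) -subr_ge0 => /le_trans; apply.
rewrite /t0 le_eqVlt; apply/orP; left; apply/eqP.
rewrite !hip !ipE (ipC x' x0) (ipC u' u0); field.
Unshelve. all: by end_near.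
Qed.

Lemma riesz (phi : H -> R) (M : R) :
  (forall x y, phi (x + y) = phi x + phi y) ->
  (forall a x, phi (a *: x) = a * phi x) ->
  (forall x, `|phi x| <= M * `|x|) ->
  exists p, forall h, phi h = ip p h.
Proof.
move=> phiD phiZ phiM.
have phiB x y : phi (x - y) = phi x - phi y.
  by rewrite phiD -scaleN1r phiZ mulN1r.
(* The function minimised is [- phi x + |x|^2 / 2], with the second variable frozen at 0; completing
   the square bounds it below by [- M^2 / 2]. *)
pose E := [set e : H * H * R | e.1.2 = 0 /\ - phi e.1.1 <= e.2].
have [||||x0 [u0 [t0 [[/= u00 t0E] h0]]]] := @convex_argmin E (- (M ^+ 2 / 2)).
- by exists (0, 0, - phi 0); split => /=.
- move=> x u t x' u' t' s /andP[s0 s1] [/= -> xt] [/= -> xt']; split => /=.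
    by rewrite subrr scaler0 addr0.
  rewrite phiD phiZ phiB -subr_ge0.
  have -> : t + s * (t' - t) - - (phi x + s * (phi x' - phi x)) =
     (1 - s) * (t - - phi x) + s * (t' - - phi x') by ring.
  by rewrite addr_ge0// mulr_ge0// subr_ge0.
- move=> x u t x0 u0 t0 xE xx0 uu0 tt0; split => /=.
    have u0n : u = fun=> 0 by apply/funext => n; have [] := xE n.
    by move: uu0; rewrite u0n => /cvg_lim <-//; rewrite lim_cst.
  have cv : t n + M * `|x n - x0| @[n --> \oo] --> t0.
    rewrite -[X in _ --> X]addr0 -(mulr0 M); apply: cvgD => //; apply: cvgMr.
    by rewrite -(@normr0 _ H) -(subrr x0); apply: cvg_norm; apply: cvgB => //; exact: cvg_cst.
  apply: (cvgr_to_ge cv); near=> n.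
  have [_ /=] := xE n; have := phiM (x n - x0); rewrite phiB ler_norml.
  by move=> /andP[_]; lra.
- move=> x u t [/= -> xt]; rewrite normr0 expr0n addr0.
  have := phiM x; rewrite ler_norml => /andP[_ h].
  have := sqr_ge0 (`|x| - M); nra.
exists x0 => h.
(* The first-order condition gives one inequality in every direction; applied to [- h] as well, it
   becomes an equality. *)
have key v : phi v <= ip x0 v.
  have Ev : E (x0 + v, 0, - phi (x0 + v)) by split => /=.
  have := h0 _ _ _ Ev.
  by rewrite u00 subrr ip0r addr0 (addrC x0) addrK phiD; lra.
apply/eqP; rewrite eq_le key/=.
by have := key (- h); rewrite -scaleN1r phiZ ipZr; lra.
Unshelve. all: by end_near.
Qed.

(* Simons and Zalinescu: minimise the Fitzpatrick function of [T], given by its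
   epigraph, plus half the squared norm; [(x, -x)] is then in the graph. *)
Lemma minty0 (T : H -> set H) : set_monotone ip T ->
  (forall x u, (forall y v, T y v -> 0 <= ip (x - y) (u - v)) -> T x u) ->
  exists x, T x (- x).
Proof.
move=> monT maxT.
pose E := [set e : H * H * R |
  forall y v, T y v -> ip y e.1.2 + ip e.1.1 v - ip y v <= e.2].
(* Were the graph empty, the hypothesis [maxT] would hold vacuously at [(0, 0)] and put that point
   in it. *)
have [y0 [v0 T0]] : exists y v, T y v.
  apply: contrapT => T0; apply: (T0); exists 0, 0; apply: maxT => y v Tyv.
  by exfalso; apply: T0; exists y, v.
(* If [t < ip x u], then [(x, u)] is monotonically related to the graph, so belongs to it; testing
   [E] at that very point gives [ip x u <= t]. *)
have lbE x u t : E (x, u, t) -> ip x u <= t.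
  move=> Ext; rewrite leNgt; apply/negP => ht.
  have /(Ext _ _)/= : T x u.
    apply: maxT => y v /Ext/=; rewrite !ipE => h; lra.
  by lra.
have [||||x0 [u0 [t0 [E0 h0]]]] := @convex_argmin E 0.
- exists (y0, v0, ip y0 v0) => y v /(monT _ _ _ _ T0) /=; rewrite !ipE; lra.
- move=> x u t x' u' t' s /andP[s0 s1] Ex Ex' y v Tyv /=.
  have := Ex _ _ Tyv; have := Ex' _ _ Tyv; rewrite /= !ipE => h' h.
  rewrite -subr_ge0 in h; rewrite -subr_ge0 in h'; rewrite -subr_ge0.
  have := mulr_ge0 s0 h'; have s1' : 0 <= 1 - s by rewrite subr_ge0.
  by have := mulr_ge0 s1' h; lra.
- move=> x u t x0 u0 t0 xE xx0 uu0 tt0 y v Tyv /=.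
  apply: (@ler_cvg_to _ \oo _ _ (fun n => ip y (u n) + ip (x n) v - ip y v) t) => //.
    apply: cvgB; last exact: cvg_cst.
    by apply: cvgD; apply: cvg_ip => //; exact: cvg_cst.
  by near=> n; exact: xE.
- move=> x u t /lbE h; rewrite !hip; have := ip_ge0 (x + u).
  by rewrite !ipE (ipC u x); lra.
have Tu0 : T (- u0) (- x0).
  apply: maxT => y v Tyv.
  have Eyv : E (y, v, ip y v).
    by move=> y' v' /(monT _ _ _ _ Tyv) /=; rewrite !ipE; lra.
  have := h0 _ _ _ Eyv; have := lbE _ _ _ E0; have := ip_ge0 (x0 + u0).
  by rewrite !ipE (ipC u0 x0) (ipC y x0); lra.
exists (- u0).
(* The first-order condition at the graph point [(- u0, - x0)], combined with [ip x0 u0 <= t0],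
   forces [|x0 + u0|^2 <= 0]. *)
have : ip (x0 + u0) (x0 + u0) = 0.
  apply/eqP; rewrite eq_le ip_ge0 andbT.
  have := E0 _ _ Tu0; have := lbE _ _ _ E0.
  have Eyv : E (- u0, - x0, ip (- u0) (- x0)).
    by move=> y' v' /(monT _ _ _ _ Tu0) /=; rewrite !ipE; lra.
  have := h0 _ _ _ Eyv.
  by rewrite /= !ipE !(ipC u0 x0); lra.
by move=> /ip_eq0/eqP; rewrite addr_eq0 => /eqP e; rewrite -{2}e.
Unshelve. all: by end_near.
Qed.

(** * Resolvents and zeros of maximal monotone operators *)

Lemma maximal_monotoneP (A : H -> set H) (x u : H) : maximal_monotone ip A ->
  (forall y v, A y v -> 0 <= ip (x - y) (u - v)) -> A x u.
Proof.
move=> [monA maxA] h.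
(* Adjoining the pair [(x, u)] to the graph keeps it monotone. *)
apply: (maxA (fun y => A y `|` [set v | y = x /\ v = u])); last by right.
  move=> y y' v v' [Ay|[-> ->]] [Ay'|[-> ->]].
  - exact: monA.
  - by have := h _ _ Ay; rewrite !ipE; lra.
  - exact: h.
  - by rewrite subrr ip0l.
by move=> y v; left.
Qed.

Lemma resolventP (A : H -> set H) (lam : R) (v : H) :
  maximal_monotone ip A -> 0 < lam ->
  A (resolvent A lam v) (lam^-1 *: (v - resolvent A lam v)).
Proof.
move=> hA lam0.
have [x Tx] : exists x, A x (lam^-1 *: (- x + v)).
  have lamN0 : lam != 0 by rewrite gt_eqF.
  (* Minty's theorem is used for [lam A] shifted by [v]: a point whose image contains [- x] solves
     [v \in x + lam A(x)]. *)
  apply: (@minty0 (fun x u => A x (lam^-1 *: (u + v)))).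
    move=> x y a b Ax Ay; have := hA.1 _ _ _ _ Ax Ay.
    by rewrite -scalerBr opprD addrACA subrr addr0 ipZr pmulr_rge0 ?invr_gt0.
  move=> x u h; apply: maximal_monotoneP => // y w Ayw.
  have /h : A y (lam^-1 *: ((lam *: w - v) + v)).
    by rewrite subrK scalerA mulVf// scale1r.
  rewrite -(pmulr_rge0 _ (_ : 0 < lam^-1)) ?invr_gt0// -ipZr.
  by rewrite opprB addrA scalerBr scalerA mulVf// scale1r.
have : (exists y, [set y | [set y + lam *: a | a in A y] v] y).
  exists x => /=; exists (lam^-1 *: (- x + v)) => //.
  by rewrite scalerA divff ?gt_eqF// scale1r addrA subrr add0r.
move=> /(xgetPex 0)/= [a Aa e].
rewrite -/(resolvent A lam v) in Aa e *.
rewrite -{2}e addrAC subrr add0r scalerA mulVf ?gt_eqF// scale1r.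
exact: Aa.
Qed.

Lemma resolvent_nonexpansive (A : H -> set H) (lam : R) (v v' : H) :
  maximal_monotone ip A -> 0 < lam ->
  `|resolvent A lam v - resolvent A lam v'| <= `|v - v'|.
Proof.
move=> hA lam0; have Av := resolventP A lam v hA lam0.
have Av' := resolventP A lam v' hA lam0.
move: (resolvent A lam v) (resolvent A lam v') Av Av' => y y' Av Av'.
have [->|yy'] := eqVneq y y'; first by rewrite subrr normr0.
rewrite -(ler_pM2l (_ : 0 < `|y - y'|)); last by rewrite normr_gt0 subr_eq0.
apply: le_trans (cauchy_schwarz _ _); rewrite -expr2 hip.
have := hA.1 _ _ _ _ Av Av'.
rewrite -scalerBr ipZr pmulr_rge0 ?invr_gt0//.
by rewrite !ipE; lra.
Qed.

(** This is maximality of [A + B] at [(p, 0)]. With [t = 1 / (2 L)], the map [q |-> J_t (p - t B q)]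
    is a contraction of factor [1 / 2]; at its fixed point [q], [(p - q) / t] lies in [(A + B)(q)],
    and the hypothesis then yields [q = p]. *)
Lemma zeros_sumP (A : H -> set H) (B : H -> H) (L : R) (p : H) :
  maximal_monotone ip A -> 0 < L ->
  (forall x y, `|B x - B y| <= L * `|x - y|) ->
  (forall q a, A q a -> 0 <= ip (p - q) (- (a + B q))) -> zeros_sum A B p.
Proof.
move=> hA L0 BL h.
pose t := (2 * L)^-1.
have t0 : 0 < t by rewrite invr_gt0; lra.
have it0 : 0 < t^-1 by rewrite invr_gt0.
have [|x y|q qE] := @lipschitz_fixed_point R H (fun q => resolvent A t (p - t *: B q)) 2^-1.
- lra.
- apply: le_trans (resolvent_nonexpansive _ _ _ _ hA t0) _.
  rewrite opprB addrC addrA subrK -scalerBr normrZ gtr0_norm// distrC.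
  have -> : 2^-1 * `|x - y| = t * (L * `|x - y|).
    by rewrite /t; field; rewrite gt_eqF.
  by rewrite ler_pM2l.
have := resolventP A t (p - t *: B q) hA t0; rewrite {}qE.
rewrite addrAC scalerBr scalerA mulVf ?gt_eqF// scale1r => Aq.
have := h _ _ Aq; rewrite subrK ipNr ipZr oppr_ge0 (pmulr_rle0 _ it0) => pq.
have /ip_eq0/eqP : ip (p - q) (p - q) = 0 by apply/eqP; rewrite eq_le pq ip_ge0.
rewrite subr_eq0 => /eqP pqE; rewrite -pqE in Aq *.
by exists (t^-1 *: (p - p) - B p) => //; rewrite subrr scaler0 sub0r addNr.
Qed.

(** * Weak limits and Opial's lemma *)

Lemma ultra_weak_limit (T : Type) (U : set_system T) (x : T -> H) (M : R) :
  UltraFilter U -> (forall n, `|x n| <= M) ->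
  exists p, forall h, ip (x n) h @[n --> U] --> ip p h.
Proof.
move=> UU xM.
have M0 (h : H) n : `|ip (x n) h| <= M * `|h|.
  by rewrite (le_trans (cauchy_schwarz_abs _ _))// ler_wpM2r.
(* The limits along [U] form a bounded linear functional of [h], which the Riesz theorem represents
   by the weak limit. *)
have /choice[phi phiP] : forall h, exists l : R, ip (x n) h @[n --> U] --> l.
  by move=> h; exact: ultra_bounded_cvg (M0 h).
have cvgE (f : T -> R) (l l' : R) : f @ U --> l -> f @ U --> l' -> l = l'.
  by move=> fl fl'; apply: (cvg_unique _ fl fl').
have [h h'|a h|h|p pE] := @riesz phi M; last 1 first.
- by exists p => h; rewrite -pE.
- apply: cvgE (phiP (h + h')) _; under eq_fun do rewrite ipDr.
  exact: cvgD.
- by apply: cvgE (phiP (a *: h)) _; under eq_fun do rewrite ipZr; exact: cvgMr.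
- by apply: (cvgr_to_le (cvg_norm (phiP h))); exact: nearW.
Qed.

(* Opial's lemma, with weak cluster points taken along ultrafilters. *)
Lemma opial (x : nat -> H) (M : R) (S : set H) :
  (forall n, `|x n| <= M) ->
  (forall p, S p -> cvgn (fun n => `|x n - p| ^+ 2)) ->
  (forall U p, UltraFilter U -> \oo `<=` U ->
    (forall h, ip (x n) h @[n --> U] --> ip p h) -> S p) ->
  exists2 p, S p & weakly_converges_to ip x p.
Proof.
move=> xM cvS clS.
have weak U : UltraFilter U -> \oo `<=` U ->
    exists2 p, S p & forall h, ip (x n) h @[n --> U] --> ip p h.
  move=> UU ooU; have [p px] := ultra_weak_limit nat U x M UU xM.
  by exists p => //; exact: clS px.
have [U [UU ooU]] := ultraFilterLemma (_ : ProperFilter \oo).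
have [p Sp px] := weak U UU ooU.
exists p => // h; apply: cvg_ultra => V VU ooV.
have [q Sq qx] := weak V VU ooV.
suff -> : p = q by exact: qx.
(* Up to a constant, [ip (x n) (p - q)] is half the difference of two convergent squared distances.
   Its limit is the same along [U] and [V], so [ip p (p - q) = ip q (p - q)]. *)
have [l lP] : exists l : R, ip (x n) (p - q) @[n --> \oo] --> l.
  have /cvg_ex[lp lpP] := cvS _ Sp; have /cvg_ex[lq lqP] := cvS _ Sq.
  exists ((lq - lp + (`|p| ^+ 2 - `|q| ^+ 2)) / 2).
  have -> : (fun n => ip (x n) (p - q)) = fun n =>
      (`|x n - q| ^+ 2 - `|x n - p| ^+ 2 + (`|p| ^+ 2 - `|q| ^+ 2)) / 2.
    by apply/funext => n; rewrite !hip !ipE (ipC p (x n)) (ipC q (x n)); field.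
  by apply: cvgMl; apply: cvgD; [exact: cvgB|exact: cvg_cst].
have cvgE (W : set_system nat) r : UltraFilter W -> \oo `<=` W ->
    ip (x n) (p - q) @[n --> W] --> ip r (p - q) -> ip r (p - q) = l.
  move=> WU ooW rP; apply: (cvg_unique _ rP) => //.
  by move=> N /lP; exact: ooW.
apply/eqP; rewrite -subr_eq0; apply/eqP/ip_eq0.
by rewrite ipDl ipNl (cvgE U p)// (cvgE V q)// subrr.
Qed.

(** * Estimates for one iteration *)

Lemma inertial_step (alpha beta theta : R) (x0 x1 x2 z w u p : H) :
  0 < alpha < 1 -> 0 <= beta -> 0 <= theta <= 1 ->
  z = x1 + beta *: (x1 - x0) -> w = x1 + theta *: (x1 - x0) ->
  x2 = (1 - alpha) *: z + alpha *: u -> `|u - p| ^+ 2 <= `|w - p| ^+ 2 ->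
  let s := (1 - alpha) * beta + alpha * theta in
  `|x2 - p| ^+ 2 <= (1 + s) * `|x1 - p| ^+ 2 - s * `|x0 - p| ^+ 2
    + ((1 - alpha) * beta * (1 + beta) + 2 * alpha
       + (1 - alpha) * beta * (1 - beta) / alpha) * `|x1 - x0| ^+ 2
    - (1 - alpha) * (1 - beta) / alpha * `|x2 - x1| ^+ 2.
Proof.
move=> /andP[a0 a1] b0 /andP[t0 t1] zE wE x2E; rewrite -subr_ge0 => upw /=.
have aN0 : alpha != 0 by rewrite gt_eqF.
(* The gap between the two sides is exactly the sum of three nonnegative terms: the gain from [w] to
   [u], a second difference left over from expanding [|u - z|^2], and the slack in replacing
   [theta + theta^2] by 2. *)
have h1 := mulr_ge0 (ltW a0) upw.
have h2 : 0 <= beta * (1 - alpha) / alpha * `|(x2 - x1) - (x1 - x0)| ^+ 2.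
  by rewrite mulr_ge0// divr_ge0 ?mulr_ge0//; lra.
have h3 : 0 <= alpha * (2 - theta - theta ^+ 2) * `|x1 - x0| ^+ 2.
  by rewrite mulr_ge0// mulr_ge0//; [lra|nra].
rewrite -subr_ge0; apply: le_trans (addr_ge0 (addr_ge0 h1 h2) h3) _.
rewrite le_eqVlt; apply/orP; left; apply/eqP.
rewrite !hip x2E wE zE !ipE (ipC x1 x0) (ipC u x0) (ipC u x1) (ipC p x0)
  (ipC p x1) (ipC p u).
by field.
Qed.

(* One step of the method: [u] is obtained from [w] by a relaxed projection onto
   the half-space [{v | <y - v, d> >= 0}], which contains the zeros of [A + B]. *)
Lemma projection_step (A : H -> set H) (B : H -> H) (lam kappa gamma eta : R)
    (w y d u : H) :
  set_monotone ip A -> monotone_map ip B -> 0 < lam -> kappa < 1 ->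
  0 < gamma < 2 -> A y (lam^-1 *: (w - lam *: B w - y)) ->
  lam * `|B w - B y| <= kappa * `|w - y| ->
  d = w - y - lam *: (B w - B y) ->
  eta = (if d != 0 then ip (w - y) d / `|d| ^+ 2 else 0) ->
  u = w - (gamma * eta) *: d ->
  (forall p, zeros_sum A B p -> `|u - p| ^+ 2 <= `|w - p| ^+ 2) /\
  gamma * (1 - kappa) * `|w - y| <= (1 + kappa) * `|u - w|.
Proof.
move=> monA monB lam0 k1 /andP[g0 g2] Ay lamB dE etaE uE.
have kwy : 0 <= kappa * `|w - y|.
  by apply: le_trans lamB; rewrite mulr_ge0// ltW.
have wyd : (1 - kappa) * `|w - y| ^+ 2 <= ip (w - y) d.
  rewrite dE ipDr ipNr ipZr -hip.
  have := cauchy_schwarz (w - y) (B w - B y); rewrite -(ler_pM2l lam0).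
  have := ler_wpM2l (normr_ge0 (w - y)) lamB.
  by lra.
have d_le : `|d| <= (1 + kappa) * `|w - y|.
  rewrite dE; apply: le_trans (ler_normB _ _) _.
  by rewrite normrZ gtr0_norm// mulrDl mul1r lerD2l.
have [d0|dN0] := eqVneq d 0.
  have -> : u = w by rewrite uE d0 scaler0 subr0.
  split=> //; rewrite subrr normr0 mulr0.
  move: wyd; rewrite d0 ip0r pmulr_rle0 ?subr_gt0// => wy0.
  have /eqP : `|w - y| ^+ 2 = 0 by apply/eqP; rewrite eq_le wy0 sqr_ge0.
  by rewrite expf_eq0/= => /eqP ->; rewrite mulr0.
rewrite dN0 in etaE.
have nd0 : 0 < `|d| by rewrite normr_gt0.
have etad : eta * `|d| ^+ 2 = ip (w - y) d.
  by rewrite etaE divfK// expf_eq0/= gt_eqF.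
have eta0 : 0 <= eta.
  rewrite etaE divr_ge0//; apply: le_trans wyd.
  by rewrite mulr_ge0// subr_ge0 ltW.
split.
  move=> p [b Ap bB]; have {}bB : b = - B p by apply/eqP; rewrite -addr_eq0 bB.
  rewrite {}bB in Ap.
  (* Monotonicity of [A] and of [B] between [y] and [p] places [p] in the half-space. *)
  have ypd : 0 <= ip (y - p) d.
    have := monA _ _ _ _ Ay Ap; rewrite -(pmulr_rge0 _ lam0).
    rewrite -ipZr opprK scalerDr scalerA divff ?gt_eqF// scale1r.
    have := mulr_ge0 (ltW lam0) (monB y p).
    by rewrite dE !ipE; lra.
  have wpd : eta * `|d| ^+ 2 <= ip (w - p) d.
    by move: ypd; rewrite etad !ipE; lra.
  have -> : `|u - p| ^+ 2 =
      `|w - p| ^+ 2 - 2 * (gamma * (eta * ip (w - p) d))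
      + (gamma * eta) ^+ 2 * `|d| ^+ 2.
    by rewrite uE !hip !ipE (ipC p w) (ipC d w) (ipC d p); ring.
  have := ler_wpM2l (ltW g0) (ler_wpM2l eta0 wpd).
  have : 0 <= gamma * (2 - gamma) * (eta ^+ 2 * `|d| ^+ 2).
    by rewrite !mulr_ge0 ?sqr_ge0//; lra.
  by lra.
have -> : `|u - w| = gamma * eta * `|d|.
  by rewrite uE addrAC subrr add0r normrN normrZ ger0_norm// mulr_ge0// ltW.
have -> : (1 + kappa) * (gamma * eta * `|d|) =
  gamma * ((1 + kappa) * (eta * `|d|)) by ring.
rewrite -(mulrA gamma) ler_pM2l// -(ler_pM2r nd0).
have -> : (1 + kappa) * (eta * `|d|) * `|d| = (1 + kappa) * (eta * `|d| ^+ 2).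
  by ring.
rewrite etad; apply: le_trans (ler_wpM2l _ wyd); last first.
  (* The sign of [1 + kappa] is read off from [0 < |d| <= (1 + kappa) |w - y|]. *)
  have [wy0|wyN0] := eqVneq `|w - y| 0.
    by move: d_le; rewrite wy0 mulr0 leNgt nd0.
  have : 0 < (1 + kappa) * `|w - y| by exact: lt_le_trans d_le.
  by rewrite pmulr_lgt0 => [/ltW //|]; rewrite lt_def wyN0 normr_ge0.
rewrite mulrCA expr2 mulrA; apply: le_trans (ler_wpM2l _ d_le) _.
  by rewrite mulr_ge0// subr_ge0 ltW.
by rewrite le_eqVlt; apply/orP; left; apply/eqP; ring.
Qed.

(** * Asymptotics of the iterates *)

Lemma sqr_norm_cvg0 (T : Type) (F : set_system T) (FF : Filter F) (x : T -> H) :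
  `|x n| ^+ 2 @[n --> F] --> (0 : R) -> x @ F --> (0 : H).
Proof.
move=> x0; apply/cvgr0Pnorm_lt => e e0.
have e20 : 0 < e ^+ 2 by rewrite exprn_gt0.
near=> n; rewrite -(ltr_pXn2r (n := 2)) ?nnegrE ?(ltW e0)//.
apply: le_lt_trans (ler_norm _) _; near: n.
exact: (cvgr0_norm_lt _ x0).
Unshelve. all: by end_near.
Qed.

Lemma bounded_sqr_dist (x : nat -> H) (p : H) (M : R) :
  (forall n, `|x n - p| ^+ 2 <= M) -> exists M', forall n, `|x n| <= M'.
Proof.
move=> xM; exists (1 + M + `|p|) => n.
rewrite -[x n in leLHS](subrK p) (le_trans (ler_normD _ _))// lerD2r.
have := sqr_ge0 (`|x n - p| - 1); have := xM n; have := sqr_ge0 `|x n - p|.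
by lra.
Qed.

(** Writing [a n] for the squared distance, vanishing steps and boundedness give
    [a n.+1 - a n --> 0]; hence [(1 - s n) * a n] converges, and [1 - s n] has a positive limit. *)
Lemma cvg_sqr_dist (x : nat -> H) (p : H) (s : nat -> R) (s0 M : R) :
  (forall n, `|x n| <= M) -> (fun n => x n.+1 - x n) @ \oo --> (0 : H) ->
  s @ \oo --> s0 -> s0 < 1 ->
  cvgn (fun n => `|x n.+1 - p| ^+ 2 - s n * `|x n - p| ^+ 2) ->
  cvgn (fun n => `|x n - p| ^+ 2).
Proof.
move=> xM dx0 ss0 s01 /cvg_ex[g gP].
have dd : `|x n.+1 - p| ^+ 2 - `|x n - p| ^+ 2 @[n --> \oo] --> (0 : R).
  apply: (@norm_cvg0 _ R^o).
  apply: (@squeeze_cvgr _ _ _ _ (fun=> 0)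
      (fun n => (2 * M + 2 * `|p|) * `|x n.+1 - x n|)).
  - near=> n; rewrite normr_ge0/=.
    have -> : `|x n.+1 - p| ^+ 2 - `|x n - p| ^+ 2 =
        ip (x n.+1 + x n - (p + p)) (x n.+1 - x n).
      by rewrite !hip !ipE (ipC p (x n)) (ipC p (x n.+1)) (ipC (x n.+1) (x n)); ring.
    apply: le_trans (cauchy_schwarz_abs _ _) _; rewrite ler_wpM2r//.
    apply: le_trans (ler_normB _ _) _.
    have -> : 2 * M + 2 * `|p| = (M + M) + (`|p| + `|p|) by ring.
    by rewrite lerD// (le_trans (ler_normD _ _))// lerD.
  - exact: cvg_cst.
  - rewrite -(mulr0 (2 * M + 2 * `|p|)) -(@normr0 _ H).
    by apply: cvgMr; exact: cvg_norm.
have s10 : 1 - s0 != 0 by rewrite gt_eqF// subr_gt0.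
apply/cvg_ex; exists ((1 - s0)^-1 * g).
have h : (1 - s n)^-1 * ((`|x n.+1 - p| ^+ 2 - s n * `|x n - p| ^+ 2) -
    (`|x n.+1 - p| ^+ 2 - `|x n - p| ^+ 2)) @[n --> \oo] --> (1 - s0)^-1 * g.
  apply: cvgM; last by rewrite -[X in _ --> X]subr0; exact: cvgB.
  by apply: cvgV => //; apply: cvgB => //; exact: cvg_cst.
apply: cvg_trans h; apply: near_eq_cvg; near=> n.
field; rewrite gt_eqF// subr_gt0; near: n.
exact: (cvgr_lt _ ss0).
Unshelve. all: by end_near.
Qed.

(* The weak cluster points are zeros by demiclosedness of the graph of [A + B]:
   [e n] is an element of [(A + B) (y n)] tending to [0]. *)
Lemma weak_cluster_zero (A : H -> set H) (B : H -> H) (L : R)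
    (U : set_system nat) (x y e : nat -> H) (M : R) (p : H) :
  maximal_monotone ip A -> monotone_map ip B -> 0 < L ->
  (forall x y, `|B x - B y| <= L * `|x - y|) ->
  ProperFilter U -> (forall n, `|x n| <= M) ->
  (forall h, ip (x n) h @[n --> U] --> ip p h) ->
  (fun n => y n - x n) @ U --> (0 : H) -> e @ U --> (0 : H) ->
  (forall n, A (y n) (e n - B (y n))) -> zeros_sum A B p.
Proof.
move=> hA monB L0 BL UU xM xp yx e0 Ay.
apply: (zeros_sumP _ _ _ _ hA L0 BL) => q a Aq.
have xe : ip (x n) (e n) @[n --> U] --> (0 : R).
  apply: (@norm_cvg0 _ R^o).
  apply: (@squeeze_cvgr _ _ _ _ (fun=> 0) (fun n => M * `|e n|)).
  - near=> n; rewrite normr_ge0/= (le_trans (cauchy_schwarz_abs _ _))//.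
    by rewrite ler_wpM2r.
  - exact: cvg_cst.
  - by rewrite -(mulr0 M) -(@normr0 _ H); apply: cvgMr; exact: cvg_norm.
(* The left side is [ip (y n - q) (e n - (a + B q))], split so that every term with a merely weak
   limit is paired either with a fixed vector or with [e n]. *)
have h : ip (x n) (e n) + ip ((y n - x n) - q) (e n - (a + B q))
    - ip (x n) (a + B q) @[n --> U] -->
    0 + ip (0 - q) (0 - (a + B q)) - ip p (a + B q).
  apply: cvgB => //; apply: cvgD => //; apply: cvg_ip => //.
  - by apply: cvgB => //; exact: cvg_cst.
  - by apply: cvgB => //; exact: cvg_cst.
have -> : ip (p - q) (- (a + B q)) =
    0 + ip (0 - q) (0 - (a + B q)) - ip p (a + B q) by rewrite !ipE; ring.
apply: (cvgr_to_ge h); near=> n.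
have := hA.1 _ _ _ _ (Ay n) Aq; have := monB (y n) q.
by rewrite !ipE; lra.
Unshelve. all: by end_near.
Qed.

(** Stated for a run reindexed from 0, with [x] shifted by one against the other sequences, so that
    it applies to a tail. The stepsize bound involves [lam n] itself, at the price of a constant
    [kappa < 1]. *)
Lemma weak_convergence (A : H -> set H) (B : H -> H)
    (L alpha beta kappa gamma l : R) (theta lam eta : nat -> R)
    (x z w y d u : nat -> H) :
  maximal_monotone ip A -> monotone_map ip B -> 0 < L ->
  (forall x y, `|B x - B y| <= L * `|x - y|) -> zeros_sum A B !=set0 ->
  0 < alpha < 1 / 3 -> 0 <= beta < (1 - 3 * alpha) / (3 * (1 - alpha)) ->
  (forall n, 0 <= theta n <= 1) -> (forall n, theta n <= theta n.+1) ->
  kappa < 1 -> 0 < gamma < 2 ->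
  (forall n, 0 < lam n) -> 0 < l -> lam @ \oo --> l ->
  (forall n, lam n * `|B (w n) - B (y n)| <= kappa * `|w n - y n|) ->
  (forall n, z n = x n.+1 + beta *: (x n.+1 - x n)) ->
  (forall n, w n = x n.+1 + theta n *: (x n.+1 - x n)) ->
  (forall n, A (y n) ((lam n)^-1 *: (w n - lam n *: B (w n) - y n))) ->
  (forall n, d n = w n - y n - lam n *: (B (w n) - B (y n))) ->
  (forall n, eta n = if d n != 0 then ip (w n - y n) (d n) / `|d n| ^+ 2 else 0) ->
  (forall n, u n = w n - (gamma * eta n) *: d n) ->
  (forall n, x n.+2 = (1 - alpha) *: z n + alpha *: u n) ->
  exists2 p : H, zeros_sum A B p & weakly_converges_to ip x p.
Proof.
move=> hA monB L0 BL [p0 Sp0] halpha hbeta theta01 thetaS k1 hgamma lam0 l0 lamP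
  lamB zE wE Ay dE etaE uE xE.
have step n := projection_step _ _ _ _ _ _ _ _ _ _
  hA.1 monB (lam0 n) k1 hgamma (Ay n) (lamB n) (dE n) (etaE n) (uE n).
have /andP[a0 a13] := halpha; have /andP[b0 b13] := hbeta.
have aN0 : alpha != 0 by rewrite gt_eqF.
have a01 : 0 < alpha < 1 by rewrite a0/=; lra.
(* This rewriting of the bound on [beta] is what yields [s n <= 1 / 3]. *)
have ab : (1 - alpha) * beta < 1 / 3 - alpha.
  by move: b13; rewrite ltr_pdivlMr; lra.
pose s n := (1 - alpha) * beta + alpha * theta n.
have ab0 : 0 <= (1 - alpha) * beta by rewrite mulr_ge0//; lra.
have s01 n : 0 <= s n <= 1 / 3.
  have /andP[t0 t1] := theta01 n; have := ler_wpM2l (ltW a0) t1.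
  by have := mulr_ge0 (ltW a0) t0; rewrite /s; lra.
have sS n : s n <= s n.+1 by rewrite lerD2l ler_pM2l.
set r := (1 - alpha) * beta * (1 + beta) + 2 * alpha
    + (1 - alpha) * beta * (1 - beta) / alpha.
have r0 : 0 <= r.
  have b1 : beta <= 1 by move: ab; nra.
  apply: addr_ge0; last by rewrite divr_ge0 ?(ltW a0)// mulr_ge0//; lra.
  by apply: addr_ge0; [apply: mulr_ge0 => //; lra|lra].
have rq : 0 <= r < (1 - alpha) * (1 - beta) / alpha.
  by rewrite r0; exact: inertial_coef_lt.
have descent p (Sp : zeros_sum A B p) := inertial_descent _
  (fun n => `|x n - p| ^+ 2) (fun n => `|x n.+1 - x n| ^+ 2) s r _ rq
  (fun n => sqr_ge0 _) (fun n => sqr_ge0 _) s01 sS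
  (fun n => inertial_step _ _ _ _ _ _ _ _ _ _ a01 b0 (theta01 n)
     (zE n) (wE n) (xE n) ((step n).1 p Sp)).
have [[M0 xM0] /sqr_norm_cvg0 dx0 _] := descent p0 Sp0.
have [M xM] := bounded_sqr_dist _ _ _ xM0.
have /cvg_ex[th thP] : cvgn theta.
  apply: nondecreasing_is_cvgn; first exact/nondecreasing_seqP.
  by exists 1 => _ [n _ <-]; have /andP[] := theta01 n.
have sP : s @ \oo --> (1 - alpha) * beta + alpha * th.
  by apply: cvgD; [exact: cvg_cst|exact: cvgMr].
have th1 : th <= 1.
  by apply: (cvgr_to_le thP); apply: nearW => n; have /andP[] := theta01 n.
have uw0 : (fun n => u n - w n) @ \oo --> (0 : H).
  (* Here [u - z] is [x n.+2 - z n] divided by [alpha], and [z - w] is [beta - theta n] times the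
     last step. *)
  have -> : (fun n => u n - w n) = fun n =>
    alpha^-1 *: ((x n.+2 - x n.+1) - beta *: (x n.+1 - x n))
      + (beta - theta n) *: (x n.+1 - x n).
    apply/funext => n; have -> : x n.+2 - x n.+1 - beta *: (x n.+1 - x n) =
        alpha *: (u n - z n).
      rewrite xE zE -addrA -opprD scalerBl scale1r [alpha *: (u n - _)]scalerBr.
      by rewrite addrAC [X in X + _]addrAC subrr add0r addrC.
    rewrite scalerA mulVf// scale1r wE zE [(beta - _) *: _]scalerBl.
    by rewrite !opprD -!addrA addKr.
  have -> : 0 = alpha^-1 *: (0 - beta *: 0) + (beta - th) *: (0 : H).
    by rewrite !scaler0 subrr scaler0 addr0.
  apply: cvgD.
    apply: cvgZr; apply: cvgB; last exact: cvgZr.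
    by rewrite (cvg_shiftS (fun n => x n.+1 - x n)).
  by apply: cvgZ => //; apply: cvgB => //; exact: cvg_cst.
have wy0 : (fun n => w n - y n) @ \oo --> (0 : H).
  have /andP[g0 _] := hgamma.
  have gk0 : 0 < gamma * (1 - kappa) by rewrite mulr_gt0// subr_gt0.
  apply: norm_cvg0.
  apply: (@squeeze_cvgr _ _ _ _ (fun=> 0)
      (fun n => (gamma * (1 - kappa))^-1 * ((1 + kappa) * `|u n - w n|))).
  - by near=> n; rewrite normr_ge0/= ler_pdivlMl//; exact: (step n).2.
  - exact: cvg_cst.
  - rewrite -(mulr0 (gamma * (1 - kappa))^-1) -(mulr0 (1 + kappa)) -(@normr0 _ H).
    by apply: cvgMr; apply: cvgMr; exact: cvg_norm.
have yx0 : (fun n => y n - x n) @ \oo --> (0 : H).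
  have -> : (fun n => y n - x n) = fun n =>
      (x n.+1 - x n) + theta n *: (x n.+1 - x n) - (w n - y n).
    by apply/funext => n; rewrite (addrAC (x n.+1)) -wE opprB [RHS]addrC addrA subrK.
  have -> : 0 = 0 + th *: (0 : H) - 0 by rewrite scaler0 addr0 subr0.
  by apply: cvgB => //; apply: cvgD => //; exact: cvgZ.
pose e n := (lam n)^-1 *: (w n - y n) - (B (w n) - B (y n)).
have e0 : e @ \oo --> (0 : H).
  have -> : 0 = l^-1 *: 0 - (0 : H) by rewrite scaler0 subr0.
  apply: cvgB.
    by apply: cvgZ => //; apply: cvgV => //; rewrite gt_eqF.
  apply: norm_cvg0.
  apply: (@squeeze_cvgr _ _ _ _ (fun=> 0) (fun n => L * `|w n - y n|)).
  - by near=> n; rewrite normr_ge0/= BL.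
  - exact: cvg_cst.
  - by rewrite -(mulr0 L) -(@normr0 _ H); apply: cvgMr; exact: cvg_norm.
have Aye n : A (y n) (e n - B (y n)).
  have := Ay n; congr (A _ _).
  rewrite addrAC scalerBr scalerA mulVf ?gt_eqF// scale1r /e opprB addrA.
  by rewrite addrAC addrK.
apply: (@opial x M) => //.
  move=> p Sp; have [_ _] := descent p Sp.
  apply: cvg_sqr_dist xM dx0 sP _; have := ler_wpM2l (ltW a0) th1; lra.
move=> U p UU ooU xp.
have ooUf (f : nat -> H) : f @ \oo --> (0 : H) -> f @ U --> (0 : H).
  by move=> f0 N /f0; exact: ooU.
by apply: (@weak_cluster_zero A B L U x y e M p) => //; exact: ooUf.
Unshelve. all: by end_near.
Qed.

End Hilbert.

(** * Convergence of the stepsizes, and passage to a tail of the run *)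

Lemma partial_sums_bounded (R : realType) (xi : nat -> R) :
  (forall n, (1 <= n)%N -> 0 <= xi n) ->
  (\sum_(1 <= n <oo) (xi n)%:E < +oo)%E ->
  exists M, forall n, \sum_(0 <= i < n) xi i.+1 <= M.
Proof.
move=> xi0 xis; exists (fine (\sum_(1 <= n <oo) (xi n)%:E)%E) => n.
have h : ((\sum_(0 <= i < n) xi i.+1)%:E <= \sum_(1 <= n <oo) (xi n)%:E)%E.
  rewrite -(big_add1 _ _ 0 n.+1 xpredT xi) -sumEFin.
  by apply: nneseries_lim_ge => i i1 _; rewrite lee_fin xi0.
rewrite -lee_fin fineK// fin_numElt xis andbT.
by apply: lt_le_trans h; rewrite ltNyr.
Qed.

(** The stepsizes stay above the minimum of [m] and [lam 1], and each increase is at most a summable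
    term. *)
Lemma stepsize_cvg (R : realType) (lam xi : nat -> R) (m : R) : 0 < m ->
  0 < lam 1%N -> (forall n, (1 <= n)%N -> 0 <= xi n) ->
  (\sum_(1 <= n <oo) (xi n)%:E < +oo)%E ->
  (forall n, (1 <= n)%N -> Num.min m (lam n) <= lam n.+1 <= lam n + xi n) ->
  (forall n, (1 <= n)%N -> 0 < lam n) /\ exists2 l : R, 0 < l & lam @ \oo --> l.
Proof.
move=> m0 lam1 xi0 /(partial_sums_bounded _ _ xi0)[M xiM] lamS.
pose c := Num.min m (lam 1%N).
have c0 : 0 < c by rewrite lt_min m0.
have clam n : c <= lam n.+1.
  elim: n => [|n IHn]; first by rewrite ge_min lexx orbT.
  have /andP[+ _] := lamS n.+1 isT; apply: le_trans.
  by rewrite le_min IHn ge_min lexx.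
split=> [[//|n] _|]; first exact: lt_le_trans (clam n).
have /cvg_ex[l lP] : cvgn (fun n => lam n.+1).
  apply: (@almost_nonincreasing_cvgn _ _ (fun n => xi n.+1) c M) => //.
  - by move=> n; exact: xi0.
  - by move=> n; have /andP[] := lamS n.+1 isT.
exists l; last by rewrite -cvg_shiftS.
by apply: lt_le_trans c0 _; apply: (cvgr_to_ge lP); exact: nearW.
Qed.

Theorem theorem9 (R : realType) (H : completeNormedModType R)
  (ip : {dot H for (@idfun R)}) (hip : induces_norm ip)
  (A : H -> set H) (hA : maximal_monotone ip A)
  (B : H -> H) (hB : monotone_map ip B)
  (L : R) (hL : 0 < L) (hBL : L.-lipschitz B)
  (hOmega : zeros_sum A B !=set0)
  (alpha : R) (halpha : 0 < alpha < 1 / 3)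
  (beta : R) (hbeta : 0 <= beta < (1 - 3 * alpha) / (3 * (1 - alpha)))
  (theta : nat -> R)
  (htheta : forall n, (1 <= n)%N ->
     [/\ 0 <= theta n, theta n <= theta n.+1 & theta n.+1 <= 1])
  (mu gamma : R) (xi : nat -> R)
  (x z w y d u : nat -> H) (eta lam : nat -> R)
  (hrun : IPCMAS1_infinite_run ip A B alpha beta theta mu gamma xi
            x z w y d u eta lam) :
  exists2 p : H, zeros_sum A B p & weakly_converges_to ip x p.
Proof.
have BL v v' : `|B v - B v'| <= L * `|v - v'|.
  by have := hBL (v, v'); apply; split.
case: hrun => /andP[mu0 mu1] gamma02 lam1 xi0 xis zE wE yE ynw dE etaE uE xE
  lamE.
have lamB n : (1 <= n)%N ->
    lam n.+1 * `|B (w n) - B (y n)| <= mu * `|w n - y n|.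
  move=> n1; rewrite (lamE n n1); case: eqVneq => [->|Bwy] /=.
    by rewrite subrr normr0 mulr0 mulr_ge0// ltW.
  have nB : 0 < `|B (w n) - B (y n)| by rewrite normr_gt0 subr_eq0.
  by rewrite -ler_pdivlMr// ge_min lexx.
have [lam0 [l l0 lamP]] : (forall n, (1 <= n)%N -> 0 < lam n) /\
    exists2 l : R, 0 < l & lam @ \oo --> l.
  (* The Lipschitz bound keeps the quotient in the update of [lam] at least [mu / L]. *)
  apply: (@stepsize_cvg _ _ xi (mu / L)) => //; first by rewrite divr_gt0.
  move=> n n1; have xin0 := xi0 n n1; rewrite (lamE n n1).
  case: eqVneq => [_|Bwy] /=.
    by rewrite lexx andbT ge_min lerDl xin0 orbT.
  apply/andP; split; last by rewrite ge_min lexx orbT.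
  rewrite le_min !ge_min lerDl xin0 orbT andbT; apply/orP; left.
  have nB : 0 < `|B (w n) - B (y n)| by rewrite normr_gt0 subr_eq0.
  rewrite ler_pdivlMr// mulrAC ler_pdivrMr// -mulrA ler_pM2l//.
  by rewrite [leRHS]mulrC BL.
(* Any number strictly between [mu] and 1 would do: since [lam] has a positive limit,
   [mu * lam n < kappa * lam n.+1] eventually, which turns the run's bound on [lam n.+1] into one on
   [lam n]. *)
pose kappa := (1 + mu) / 2.
have k1 : kappa < 1 by rewrite /kappa; lra.
have : \forall n \near \oo, 0 < kappa * lam n.+1 - mu * lam n.
  have h : kappa * lam n.+1 - mu * lam n @[n --> \oo] --> kappa * l - mu * l.
    by apply: cvgB; apply: cvgMr => //; rewrite (cvg_shiftS lam).
  apply: (cvgr_gt _ h).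
  by rewrite -mulrBl mulr_gt0// /kappa; lra.
move=> [N _ kN].
(* The tail starts at [N]; the successor in the other indices avoids their irrelevant values at
   0. *)
pose x' n := x (n + N)%N; pose lam' n := lam (n + N).+1.
suff [p Sp px] : exists2 p, zeros_sum A B p & weakly_converges_to ip x' p.
  exists p => // h; rewrite -(cvg_shiftn N); exact: px.
apply: (@weak_convergence R H ip hip A B L alpha beta kappa gamma l
  (fun n => theta (n + N).+1) lam' (fun n => eta (n + N).+1) x'
  (fun n => z (n + N).+1) (fun n => w (n + N).+1) (fun n => y (n + N).+1)
  (fun n => d (n + N).+1) (fun n => u (n + N).+1)) => //.
- move=> n; have [t0 t1 t2] := htheta (n + N).+1 isT.
  by rewrite t0 (le_trans t1).
- by move=> n; have [] := htheta (n + N).+1 isT.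
- by move=> n; exact: lam0.
- by rewrite (cvg_shiftn N (fun n => lam n.+1)) (cvg_shiftS lam).
- move=> n; set j := (n + N).+1; have j1 : (1 <= j)%N by [].
  rewrite -(ler_pM2l (lam0 j.+1 isT)) mulrCA.
  apply: le_trans (ler_wpM2l (ltW (lam0 j j1)) (lamB j j1)) _.
  rewrite (mulrA _ mu) (mulrA _ kappa) ler_wpM2r// mulrC (mulrC _ kappa) ltW// -subr_gt0 kN//=.
  by rewrite /j leqW// leq_addl.
- by move=> n; exact: zE.
- by move=> n; exact: wE.
- by move=> n; rewrite yE//; apply: resolventP => //; exact: lam0.
- by move=> n; exact: dE.
- by move=> n; exact: etaE.
- by move=> n; exact: uE.
- by move=> n; exact: xE.
Qed.
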